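(* Let $x>0$ be fixed. Then $$\lim_{t\to0^+}\mathbb{E}\left(\mathbf 1_{\{\tau_x>t\}}[1-F_Y](x-X_t)\right)=\frac12\left(2-F_Y(x)-F_Y(x_-)\right).$$
   Context: On a probability space $(\Omega,\mathcal F,\mathbb P)$ let $X_t=mt+W_t+\sum_{i=1}^{N_t}Y_i$, $t\ge 0$, where $m\in\mathbb{R}$, $W$ is a standard Brownian motion, $N$ is a Poisson process with constant intensity $\lambda>0$, and $(Y_i)_{i\ge1}$ are i.i.d. real random variables with distribution function $F_Y(y)=\mathbb{P}(Y_1\le y)$; $W$, $N$ and $(Y_i)_{i\ge 1}$ are independent. For $x>0$, $\tau_x=\inf\{t\ge0: X_t\ge x\}$. $F_Y(x_-)$ is the left limit of $F_Y$ at $x$, and $[1-F_Y](y)$ means $1-F_Y(y)$. *)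

(* Defs.v *)
From HB Require Import structures.
From mathcomp Require Export all_boot all_order all_algebra.
From mathcomp Require Export finmap.
From mathcomp Require Export all_classical all_reals all_analysis.
Export Order.TTheory GRing.Theory Num.Theory.
Export numFieldNormedType.Exports.

Set Implicit Arguments.
Unset Strict Implicit.
Unset Printing Implicit Defensive.

Local Open Scope classical_set_scope.
Local Open Scope ring_scope.

(* Mutual independence of a family of set systems (sigma-algebras below): the
   product rule over every finite subfamily. *)
Definition independent d (T : measurableType d) (R : realType)
    (P : probability T R) (I : choiceType) (G : I -> set (set T)) : Prop :=
  forall (J : {fset I}) (A : I -> set T),
    (forall i, i \in J -> G i (A i)) ->
    P (\bigcap_(i in [set` J]) A i) = (\prod_(i <- J) P (A i))%E.

Definition sigma_of (T : Type) d (E : measurableType d) (X : T -> E) :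
    set (set T) :=
  preimage_set_system setT X measurable.

Definition sigma_of_family (T I : Type) d (E : measurableType d) (D : set I)
    (X : I -> T -> E) : set (set T) :=
  <<s \bigcup_(i in D) sigma_of (X i) >>.

(* Processes are indexed by R, but only their values at times t >= 0 are
   constrained or used. *)
Definition independent_increments d (T : measurableType d) (R : realType)
    (P : probability T R) (Z : R -> T -> R) : Prop :=
  forall (n : nat) (t : nat -> R), 0 <= t 0%N -> nondecreasing_seq t ->
    independent P (fun i : 'I_n => sigma_of (fun w => Z (t i.+1) w - Z (t i) w)).

(* normal_prob takes the standard deviation as its second argument and is
   not a Dirac mass when it is 0, whence s < t in bm_normal. *)
Record brownian_motion d (T : measurableType d) (R : realType)
    (P : probability T R) (W : R -> {RV P >-> R}) : Prop := {
  bm_start : {ae P, forall w, W 0 w = 0} ;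
  bm_increments : independent_increments P (fun t w => W t w) ;
  bm_normal : forall s t : R, 0 <= s -> s < t ->
    forall A : set R, measurable A ->
    P [set w | A (W t w - W s w)] = normal_prob 0 (Num.sqrt (t - s)) A ;
  bm_continuous :
    {ae P, forall w, {within `[0, +oo[, continuous (fun t : R => W t w)}} }.
Arguments brownian_motion {d T R} P W.

(* poisson_pmf is not a probability mass function at rate 0, whence s < t in
   pp_poisson. *)
Record poisson_process d (T : measurableType d) (R : realType)
    (P : probability T R) (lambda : R) (N : R -> {RV P >-> nat}) : Prop := {
  pp_start : {ae P, forall w, N 0 w = 0%N} ;
  pp_increments : independent_increments P (fun t w => (N t w)%:R) ;
  pp_poisson : forall s t : R, 0 <= s -> s < t -> forall k : nat,
    P [set w | N t w = (N s w + k)%N] =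
    (poisson_pmf (lambda * (t - s)) k)%:E ;
  pp_nondecreasing :
    {ae P, forall w (s t : R), 0 <= s -> s <= t -> (N s w <= N t w)%N} ;
  pp_right_continuous :
    {ae P, forall w (t : R), 0 <= t ->
      (N s w)%:R @[s --> t^'+] --> ((N t w)%:R : R)} }.
Arguments poisson_process {d T R} P lambda N.

Definition iid d (T : measurableType d) (R : realType) (P : probability T R)
    (Y : nat -> {RV P >-> R}) : Prop :=
  independent P (fun i => sigma_of (Y i)) /\
  forall i j (A : set R), measurable A ->
    distribution P (Y i) A = distribution P (Y j) A.
Arguments iid {d T R} P Y.

Definition independent3 d (T : measurableType d) (R : realType)
    (P : probability T R) (G1 G2 G3 : set (set T)) : Prop :=
  independent P (fun i : 'I_3 => nth set0 [:: G1; G2; G3] i).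

(* Jump sizes are numbered from 0: Y i is the (i+1)-st jump. *)
Definition jump_diffusion (T : Type) (R : realType) (m : R) (W : R -> T -> R)
    (N : R -> T -> nat) (Y : nat -> T -> R) (t : R) (w : T) : R :=
  m * t + W t w + \sum_(i < N t w) Y i w.

(* First passage time above x, with values in [0, +oo] (inf of the empty set
   is +oo). *)
Definition passage_time (T : Type) (R : realType) (X : R -> T -> R) (x : R)
    (w : T) : \bar R :=
  ereal_inf [set t%:E | t in [set t : R | 0 <= t /\ x <= X t w]].

Definition distribution_function d (T : measurableType d) (R : realType)
    (P : probability T R) (Z : {RV P >-> R}) (y : R) : R :=
  fine (@cdf _ _ _ P Z y).
Arguments distribution_function {d T R} P Z y.

Definition left_limit (R : realType) (f : R -> R) (x : R) : R :=
  lim (f y @[y --> x^'-]).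

(* Main.v *)
Require Import Defs.
From mathcomp Require Import measurable_realfun lra.

(* Write V_t = m t + W_t.  Right continuity of the paths at 0 gives, for every
   c > 0, an event of probability close to 1 on which |V_s| <= c and N_s = 0
   for all s in a common interval [0, b[.  For c < x and t < b, on this event
   tau_x > t and X_t = V_t, and the integrand is close to the two-valued
   variable 1 - F(x) + (F(x) - F(x-)) 1_{V_t > 0}, because F is right
   continuous with left limits.  Finally P(V_t > 0) tends to 1/2: W_t is
   symmetric, and the drift moves the threshold by |m| t while the density of
   W_t is at most (2 pi t)^(-1/2).  The set {tau_x > t} need not be measurable,
   P not being assumed complete; but the integral of a nonnegative function is
   a supremum over simple functions below it, so it can still be compared with
   measurable variables. *)

Local Open Scope classical_set_scope.
Local Open Scope ring_scope.

(** * Expectations of possibly non-measurable functions *)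

Lemma ge0_le_integral_nonmeasurable d (T : measurableType d) (R : realType)
    (mu : {measure set T -> \bar R}) (f g : T -> \bar R) :
  (forall w, 0 <= f w)%E -> (forall w, f w <= g w)%E ->
  (\int[mu]_w f w <= \int[mu]_w g w)%E.
Proof.
move=> f0 fg.
rewrite !ge0_integralTE //; last by move=> w; exact: le_trans (fg w).
apply: ereal_sup_le.
move=> _ [h hf <-]; exists h => // w; exact: le_trans (fg w).
Qed.

(** Additivity of the integral is applied only on the right, where every term is measurable; [f]
    enters through monotonicity alone. *)
Lemma expectation_le_add_indic d (T : measurableType d) (R : realType)
    (P : probability T R) (f g : T -> R) (B : set T) (e : R) :
  measurable_fun setT g -> measurable B -> 0 <= e ->
  (forall w, 0 <= f w) -> (forall w, 0 <= g w) ->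
  (forall w, f w <= g w + (e + \1_B w)) ->
  ('E_P[f] <= 'E_P[g] + (e%:E + P B))%E.
Proof.
move=> mg mB e0 f0 g0 fg; rewrite unlock.
have mB' : measurable_fun setT (fun w => (\1_B w : R)%:E).
  by apply/measurable_EFinP; exact: measurable_indic.
have -> : (\int[P]_w (g w)%:E + (e%:E + P B) =
    \int[P]_w ((g w)%:E + (e%:E + (\1_B w : R)%:E)))%E.
  rewrite ge0_integralD//; last 4 first.
  - by move=> w _; rewrite lee_fin.
  - exact/measurable_EFinP.
  - by move=> w _; rewrite -EFinD lee_fin addr_ge0.
  - exact: emeasurable_funD.
  rewrite ge0_integralD// ?integral_cst//= ?probability_setT ?mule1.
    by rewrite integral_indic// setIT.
by apply: ge0_le_integral_nonmeasurable => w; rewrite -?EFinD lee_fin.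
Qed.

(** Off [A] two functions with values in [0, 1] differ by at most 1, which costs the probability of
    the complement. As [f] may fail to be measurable, the two one-sided bounds need separate
    arguments. *)
Lemma expectation_dist_le d (T : measurableType d) (R : realType)
    (P : probability T R) (f g : T -> R) (A : set T) (e : R) :
  measurable_fun setT g -> measurable A -> 0 <= e ->
  (forall w, 0 <= f w <= 1) -> (forall w, 0 <= g w <= 1) ->
  (forall w, A w -> `|f w - g w| <= e) ->
  'E_P[f]%E \is a fin_num /\
  `|fine 'E_P[f]%E - fine 'E_P[g]%E| <= e + fine (P (~` A)).
Proof.
move=> mg mA e0 f01 g01 fg.
have mAC : measurable (~` A) by exact: measurableC.
have f0 w : 0 <= f w by case/andP : (f01 w).
have g0 w : 0 <= g w by case/andP : (g01 w).
have fin01 (h : T -> R) : (forall w, 0 <= h w <= 1) -> 'E_P[h]%E \is a fin_num.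
  move=> h01; apply/fin_numPlt/andP; split.
    rewrite (lt_le_trans (ltNyr 0))// expectation_ge0// => w.
    by case/andP : (h01 w).
  rewrite (le_lt_trans _ (ltry 1))// -(expectation_cst P 1) unlock.
  apply: ge0_le_integral_nonmeasurable => w; rewrite lee_fin.
    by case/andP : (h01 w).
  by case/andP : (h01 w).
have fE := fin01 _ f01; have gE := fin01 _ g01; split=> //.
have PA : P (~` A) \is a fin_num.
  exact: fin_num_measure.
have up : ('E_P[f] <= 'E_P[g] + (e%:E + P (~` A)))%E.
  apply: expectation_le_add_indic => // w.
  have [Aw|nAw] := pselect (A w).
    have := fg _ Aw; rewrite ler_norml indicE memNset/=; last exact.
    by move=> /andP[_]; lra.
  by rewrite indicE mem_set//=; case/andP: (f01 w) (g0 w) => _; lra.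
pose h w := Num.max (g w - e) 0 * \1_A w.
have h0 w : 0 <= h w by rewrite mulr_ge0// le_max lexx orbT.
have mh : measurable_fun setT h.
  apply: measurable_funM; last exact: measurable_indic.
  by apply: measurable_maxr => //; exact: measurable_funB.
have dn : ('E_P[g] <= 'E_P[f] + (e%:E + P (~` A)))%E.
  apply: (@le_trans _ _ ('E_P[h] + (e%:E + P (~` A)))%E).
    apply: expectation_le_add_indic => // w; rewrite /h.
    have [Aw|nAw] := pselect (A w).
      rewrite !indicE mem_set// memNset ?mulr1 ?addr0; last exact.
      by rewrite -lerBlDr le_max lexx.
    rewrite !indicE memNset// mem_set//= mulr0 add0r.
    by case/andP : (g01 w); lra.
  rewrite leeD2r// unlock; apply: ge0_le_integral_nonmeasurable => w.
    by rewrite lee_fin.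
  rewrite lee_fin /h; have [Aw|nAw] := pselect (A w).
    rewrite indicE mem_set// mulr1 ge_max f0 andbT.
    by have := fg _ Aw; rewrite ler_norml => /andP[]; lra.
  by rewrite indicE memNset// mulr0.
move: up dn; rewrite -(fineK fE) -(fineK gE) -(fineK PA) -!EFinD !lee_fin /=.
by move=> ? ?; rewrite ler_norml; lra.
Qed.

Lemma expectation_two_valued d (T : measurableType d) (R : realType)
    (P : probability T R) (U : set T) (a b : R) :
  measurable U ->
  'E_P[(fun w => a + (b - a) * \1_U w)%R]%E = (a + (b - a) * fine (P U))%:E.
Proof.
move=> mU.
have iU : (\1_U : T -> R) \in Lfun P 1.
  by apply/Lfun1_integrable; exact: integrable_indic.
have -> : (fun w => a + (b - a) * \1_U w)%R =
    (cst a \+ ((b - a) \o* \1_U))%R :> (T -> R).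
  by apply/funext => w /=; rewrite mulrC.
rewrite expectationD ?Lfun_cst//; last first.
  have -> : (b - a) \o* \1_U = (b - a) *: (\1_U : T -> R) :> (T -> R).
    by apply/funext => w /=; rewrite mulrC.
  exact: rpredZ.
rewrite expectationZl// expectation_cst expectation_indic//.
by rewrite [RHS]EFinD EFinM fineK// fin_num_measure.
Qed.

(** * Gaussian probabilities of half-lines *)

(** The density is even and the point 0 has no mass, so the total mass 1 is twice this one. *)
Lemma normal_prob_pos (R : realType) (s : R) : 0 < s ->
  normal_prob 0 s `]0, +oo[ = (2^-1)%:E.
Proof.
move=> s0.
have sn0 : s != 0 by rewrite gt_eqF.
have := @integral_normal_pdf R 0 s.
rewrite ge0_symfun_integralT; last 3 first.
- by move=> y; exact: normal_pdf_ge0.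
- exact: continuous_normal_pdf.
- by move=> y /=; rewrite !normal_pdfE// /normal_fun !subr0 sqrrN.
have -> : [set y : R | 0 <= y] = `[0, +oo[%classic.
  by apply/seteqP; split => y /=; rewrite in_itv/= andbT.
rewrite -integral_itv_obnd_cbnd; last first.
  by apply/measurable_EFinP/measurable_funTS; exact: measurable_normal_pdf.
rewrite -/(normal_prob 0 s `]0, +oo[).
have /fineK <- : normal_prob 0 s `]0, +oo[ \is a fin_num.
  exact: fin_num_measure.
rewrite -EFinM => /eqP; rewrite eqe => /eqP h; congr (_%:E); move: h.
by set p := fine _; lra.
Qed.

Lemma normal_prob_itv_le (R : realType) (m s a b : R) : s != 0 -> a <= b ->
  (normal_prob m s `]a, b] <= (normal_peak s * (b - a))%:E)%E.
Proof.
move=> s0 ab.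
have -> : (normal_peak s * (b - a))%:E =
    (\int[lebesgue_measure]_(y in `]a, b]) (normal_peak s)%:E)%E.
  rewrite integral_cst//= lebesgue_measure_itv/= lte_fin.
  move: ab; rewrite le_eqVlt => /predU1P[->|->]; last by rewrite EFinM EFinB.
  by rewrite ltxx mule0 subrr mulr0.
apply: ge0_le_integral => //.
- by move=> y _; rewrite lee_fin normal_pdf_ge0.
- by apply/measurable_EFinP/measurable_funTS; exact: measurable_normal_pdf.
- by move=> y _; rewrite lee_fin normal_pdf_ub.
Qed.

(** The half-lines starting at [c] and at 0 differ by an interval of length |c|, on which the
    density is at most its peak; the second one has mass 1/2. *)
Lemma normal_prob_upper_dist (R : realType) (s c : R) : 0 < s ->
  `|fine (normal_prob 0 s `]c, +oo[) - 2^-1| <= normal_peak s * `|c|.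
Proof.
move=> s0; have sn0 : s != 0 by rewrite gt_eqF.
have h a b : a <= b -> `|fine (normal_prob 0 s `]a, +oo[) -
    fine (normal_prob 0 s `]b, +oo[)| <= normal_peak s * (b - a).
  move=> ab.
  have -> : `]a, +oo[%classic = `]a, b] `|` `]b, +oo[ :> set R.
    by rewrite -itv_bndbnd_setU ?bnd_simp.
  rewrite measureU//=; last first.
    apply/seteqP; split => y //=; rewrite !in_itv/= andbT => -[/andP[_ yb]].
    by rewrite ltNge yb.
  rewrite fineD; [|exact: fin_num_measure..].
  rewrite addrK ger0_norm ?fine_ge0//.
  rewrite -lee_fin fineK; last exact: fin_num_measure.
  exact: normal_prob_itv_le.
have half : fine (normal_prob 0 s `]0, +oo[) = 2^-1 by rewrite normal_prob_pos.
rewrite -half; case: (leP 0 c) => c0.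
  by rewrite distrC (le_trans (h _ _ c0))// subr0 (ger0_norm c0).
by rewrite (le_trans (h _ _ (ltW c0)))// sub0r (ltr0_norm c0).
Qed.

Lemma normal_prob_drift_cvg (R : realType) (m : R) :
  fine (normal_prob 0 (Num.sqrt t) `](- (m * t)), +oo[)
    @[t --> 0^'+] --> (2^-1 : R).
Proof.
have bnd (t : R) : 0 < t ->
    `|fine (normal_prob 0 (Num.sqrt t) `](- (m * t)), +oo[) - 2^-1| <=
    `|m| * Num.sqrt t.
  move=> t0; have st0 : 0 < Num.sqrt t by rewrite sqrtr_gt0.
  apply: (le_trans (normal_prob_upper_dist _ _ _ st0)).
  (* The peak for standard deviation sqrt t is (2 pi t)^(-1/2), so the bound equals |m| sqrt t /
     sqrt(2 pi), and it remains to use 2 pi >= 1. *)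
  rewrite normrN normrM (gtr0_norm t0) mulrCA ler_wpM2l// /normal_peak.
  have tpi : 0 < t * pi *+ 2 by rewrite mulrn_wgt0// mulr_gt0// pi_gt0.
  rewrite (sqr_sqrtr (ltW t0)) ler_pdivrMl ?sqrtr_gt0//.
  rewrite -[leLHS](sqr_sqrtr (ltW t0)) expr2 ler_wpM2r ?sqrtr_ge0//.
  rewrite (ler_sqrt _ (ltW tpi)) -mulrnAr ler_peMr ?(ltW t0)//.
  by have := pi_ge2 R; lra.
apply/cvgrPdist_le => e e0.
have sqrt0 : `|m| * Num.sqrt t @[t --> (0 : R)^'+] --> `|m| * Num.sqrt 0.
  by apply: cvgMl_tmp; apply: cvg_at_right_filter; exact: sqrt_continuous.
rewrite sqrtr0 mulr0 in sqrt0.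
near=> t.
have t0 : 0 < t by near: t; exact: nbhs_right_gt.
rewrite distrC (le_trans (bnd _ t0))//.
rewrite -[leLHS]ger0_norm ?mulr_ge0 ?sqrtr_ge0// -normrN -sub0r.
by near: t; exact: (cvgrPdist_le _ _).1 sqrt0 _ e0.
Unshelve. all: by end_near. Qed.

(** * Uniform smallness of right-continuous paths near 0 *)

(** If |z t| > c, right continuity keeps this strict inequality just after t, hence at some rational
    time below b. A bound over an interval thus reduces to countably many times, which gives
    measurable events. *)
Lemma rat_bound_right_continuous (R : realType) (z : R -> R) (b c : R) :
  (forall t, 0 <= t -> z r @[r --> t^'+] --> z t) ->
  (forall q : rat, 0 <= (ratr q : R) <= b -> `|z (ratr q)| <= c) ->
  forall t, 0 <= t < b -> `|z t| <= c.
Proof.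
move=> zr zq t /andP[t0 tb]; rewrite leNgt; apply/negP => czt.
have : \forall r \near t^'+, c < `|z r| /\ r < b.
  near=> r; split; last by near: r; exact: nbhs_right_lt.
  near: r; apply: (cvgr_gt `|z t|) => //; exact: cvg_norm (zr t t0).
rewrite near_withinE => -[h /= h0 hz].
have [q] : exists q : rat, ratr q \in `]t, (t + h)[.
  by apply: rat_in_itvoo; rewrite ltrDl.
rewrite in_itv/= => /andP[tq qh].
have [] := hz (ratr q) _ tq.
  by rewrite /ball_/= distrC ger0_norm ?subr_ge0 ?ltW// ltrBlDl.
move=> + qb; rewrite ltNge => /negP; apply; apply: zq.
by rewrite (le_trans t0 (ltW tq)) ltW.
Unshelve. all: by end_near. Qed.

Lemma measurable_rat_bound d (T : measurableType d) (R : realType)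
    (Z : R -> T -> R) (b c : R) :
  (forall t, measurable_fun setT (Z t)) ->
  measurable
    [set w | forall q : rat, 0 <= (ratr q : R) <= b -> `|Z (ratr q) w| <= c].
Proof.
move=> mZ.
have -> :
    [set w | forall q : rat, 0 <= (ratr q : R) <= b -> `|Z (ratr q) w| <= c] =
    ~` \bigcup_(q : rat)
       [set w | (0 <= (ratr q : R) <= b) && (c < `|Z (ratr q) w|)].
  apply/seteqP; split=> [w h [q _ /= /andP[/h]]|w h q qb].
  by rewrite leNgt => /negP.
  by rewrite leNgt; apply/negP => cZ; apply: h; exists q => //=; rewrite qb.
apply: measurableC; apply: bigcupT_measurable_rat => q.
case: (0 <= (ratr q : R) <= b) => /=; last by rewrite set_false.
have mq : measurable_fun setT (fun w => `|Z (ratr q) w|).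
  exact: measurableT_comp.
have := mq measurableT _ (measurable_itv `]c, +oo[).
rewrite setTI; congr (measurable _).
by apply/seteqP; split => w /=; rewrite in_itv/= andbT.
Qed.

Lemma right_continuous_uniformly_small d (T : measurableType d) (R : realType)
    (P : probability T R) (Z : R -> T -> R) (c e : R) :
  (forall t, measurable_fun setT (Z t)) ->
  {ae P, forall w, Z 0 w = 0} ->
  {ae P, forall w t, 0 <= t -> Z r w @[r --> t^'+] --> Z t w} ->
  0 < c -> 0 < e ->
  exists2 b : R, 0 < b & exists A : set T,
    [/\ measurable A, fine (P (~` A)) <= e &
      forall w, A w -> Z 0 w = 0 /\ forall t, 0 <= t < b -> `|Z t w| <= c].
Proof.
move=> mZ Z0 Zr c0 e0.
have [M [mM PM Mgood]] : {ae P, forall w, Z 0 w = 0 /\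
    forall t, 0 <= t -> Z r w @[r --> t^'+] --> Z t w}.
  by apply: filterS2 Z0 Zr => w.
have good w : ~ M w -> Z 0 w = 0 /\
    forall t, 0 <= t -> Z r w @[r --> t^'+] --> Z t w.
  by move=> nM; apply: contrapT => h; apply: nM; exact: Mgood.
(* The path properties hold only almost surely, so a null set [M] containing all exceptions is
   removed. *)
pose E n := ~` M `&` [set w | forall q : rat,
  0 <= (ratr q : R) <= n.+1%:R^-1 -> `|Z (ratr q) w| <= c].
have mE n : measurable (E n).
  by apply: measurableI; [exact: measurableC|exact: measurable_rat_bound].
have ndE : {homo E : n k / (n <= k)%N >-> (n <= k)%O}.
  move=> n k nk; apply/subsetPset => w [nM h]; split => // q /andP[q0 qk].
  apply: h; rewrite q0 (le_trans qk)// lef_pV2 ?posrE// ler_nat ltnS//.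
(* Right continuity at 0 puts each good path in some [E n], so these increasing events exhaust the
   complement of [M]; continuity from below then gives P(E n) -> 1. *)
have UE : \bigcup_n E n = ~` M.
  apply/seteqP; split => [w [n _ []]//|w nM].
  have [Zw0 Zwr] := good w nM.
  have : \forall r \near (0 : R)^'+, `|Z r w| <= c.
    have /cvgrPdist_le /(_ _ c0) := Zwr 0 (lexx 0).
    by apply: filterS => r; rewrite Zw0 sub0r normrN.
  rewrite near_withinE => -[h /= h0 hZ].
  have [n nh] : exists n, n.+1%:R^-1 < h.
    exists (Num.truncn h^-1); rewrite invf_plt ?posrE//.
    by rewrite truncnS_gt.
  exists n => //; split=> // q /andP[q0 qn].
  (* Time 0 lies outside the punctured right neighbourhood and is settled by the initial value. *)
  move: q0; rewrite le_eqVlt => /predU1P[<-|q0].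
    by rewrite Zw0 normr0 ltW.
  apply: hZ => //.
  by rewrite /ball_/= sub0r normrN gtr0_norm// (le_lt_trans qn).
have : P (E n) @[n --> \oo] --> 1%E.
  have -> : 1%E = P (\bigcup_n E n).
    by rewrite UE probability_setC// PM sube0.
  apply: nondecreasing_cvg_mu => //; rewrite UE; exact: measurableC.
move=> /fine_cvgP[_ /cvgrPdist_le /(_ _ e0)] [n _ /(_ n (leqnn n)) /= nE].
exists n.+1%:R^-1 => //; exists (E n); split => //.
  rewrite probability_setC// fineB//; last exact: fin_num_measure.
  exact: le_trans (ler_norm _) nE.
move=> w [nM h]; have [Zw0 Zwr] := good w nM; split => // t tn.
exact: rat_bound_right_continuous Zwr h _ tn.
Qed.

(** * One-sided limits of the distribution function *)

Lemma distribution_function_itv01 d (T : measurableType d) (R : realType)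
    (P : probability T R) (Z : {RV P >-> R}) y :
  0 <= distribution_function P Z y <= 1.
Proof.
by rewrite fine_ge0//= -lee_fin fineK ?fin_num_measure// probability_le1.
Qed.

Lemma distribution_function_nd d (T : measurableType d) (R : realType)
    (P : probability T R) (Z : {RV P >-> R}) :
  {homo distribution_function P Z : y z / y <= z}.
Proof.
by move=> y z yz; rewrite fine_le ?fin_num_measure// cdf_nondecreasing.
Qed.

(** Monotonicity and boundedness make the limit exist, so the [lim] inside [left_limit] is a genuine
    limit and not a default value. *)
Lemma distribution_function_cvg_left d (T : measurableType d) (R : realType)
    (P : probability T R) (Z : {RV P >-> R}) x :
  distribution_function P Z y @[y --> x^'-] -->
    left_limit (distribution_function P Z) x.
Proof.
apply: nondecreasing_at_left_is_cvgr.
  by near=> y => u v _ _; exact: distribution_function_nd.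
near=> y; exists 1 => _ [u _ <-].
by case/andP : (distribution_function_itv01 d T R P Z u).
Unshelve. all: by end_near. Qed.

Lemma left_limit_itv d (T : measurableType d) (R : realType)
    (P : probability T R) (Z : {RV P >-> R}) x :
  0 <= left_limit (distribution_function P Z) x <= distribution_function P Z x.
Proof.
have cF := distribution_function_cvg_left d T R P Z x.
apply/andP; split.
  apply: (cvgr_to_ge cF); apply: nearW => y.
  by case/andP : (distribution_function_itv01 d T R P Z y).
apply: (cvgr_to_le cF); near=> y; apply: distribution_function_nd.
by near: y; exact: nbhs_left_le.
Unshelve. all: by end_near. Qed.

Lemma distribution_function_cvg_right d (T : measurableType d) (R : realType)
    (P : probability T R) (Z : {RV P >-> R}) x :
  distribution_function P Z y @[y --> x^'+] --> distribution_function P Z x.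
Proof.
apply: fine_cvg; rewrite fineK ?fin_num_measure//.
exact: cdf_right_continuous.
Qed.

(** For y > 0 the point x - y lies to the left of x, where F is close to its left limit; for y < 0
    it lies to the right, where F is close to F(x). At y = 0 the two sides agree. *)
Lemma ccdf_near_jump d (T : measurableType d) (R : realType)
    (P : probability T R) (Z : {RV P >-> R}) (x e : R) :
  let F := distribution_function P Z in 0 < e ->
  \forall c \near (0 : R)^'+, forall y, `|y| <= c ->
    `|(1 - F (x - y)) -
      (1 - F x + (F x - left_limit F x) * (0 < y)%R%:R)| <= e.
Proof.
move=> F e0.
have := distribution_function_cvg_right d T R P Z x.
move=> /cvgrPdist_le /(_ _ e0); rewrite near_withinE => -[h2 /= h20 H2].
have := distribution_function_cvg_left d T R P Z x.
move=> /cvgrPdist_le /(_ _ e0); rewrite near_withinE => -[h1 /= h10 H1].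
near=> c => y yc.
have ch1 : c < h1 by near: c; exact: nbhs_right_lt.
have ch2 : c < h2 by near: c; exact: nbhs_right_lt.
case: (ltgtP y 0) => y0; last first.
- by rewrite y0 subr0 mulr0 addr0 subrr normr0 ltW.
- have := H1 (x - y); rewrite /ball_/= opprB addrC subrK ltrBlDr ltrDl y0.
  move=> /(_ (le_lt_trans yc ch1) isT).
  rewrite mulr1 -/F !ler_norml => /andP[? ?]; lra.
have := H2 (x - y); rewrite /ball_/= opprB addrC subrK ltrDl oppr_gt0 y0.
move=> /(_ (le_lt_trans yc ch2) isT).
rewrite mulr0 -/F !ler_norml => /andP[? ?]; lra.
Unshelve. all: by end_near. Qed.

(** * The limit of the expectation *)

Theorem proposition2 (d : measure_display) (T : measurableType d)
    (R : realType) (P : probability T R)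
    (m lambda : R) (W : R -> {RV P >-> R}) (N : R -> {RV P >-> nat})
    (Y : nat -> {RV P >-> R})
    (lambda_gt0 : 0 < lambda)
    (W_brownian : brownian_motion P W)
    (N_poisson : poisson_process P lambda N)
    (Y_iid : iid P Y)
    (WNY_independent : independent3 P
       (sigma_of_family [set t : R | 0 <= t] (fun t => W t : T -> R))
       (sigma_of_family [set t : R | 0 <= t] (fun t => N t : T -> nat))
       (sigma_of_family [set: nat] (fun i => Y i : T -> R)))
    (x : R) (x_gt0 : 0 < x) :
  let X := jump_diffusion m (fun t => W t) (fun t => N t) (fun i => Y i) in
  let tau := passage_time X x in
  let F := distribution_function P (Y 0%N) in
  'E_P[(fun w => \1_[set w' | (t%:E < tau w')%E] w * (1 - F (x - X t w)))%R]%E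
    @[t --> 0^'+] --> ((2 - F x - left_limit F x) / 2)%:E.

Proof.
move=> X tau F.
have [W0 _ Wn Wc] := W_brownian.
have [N0 _ _ _ Nr] := N_poisson.
pose V t w := m * t + W t w.
have mV t : measurable_fun setT (V t) by exact: measurable_funD.
have mN t : measurable_fun setT (fun w => (N t w)%:R : R).
  exact: measurableT_comp.
have V0 : {ae P, forall w, V 0 w = 0}.
  by apply: filterS W0 => w; rewrite /V mulr0 add0r.
have Vr : {ae P, forall w t, 0 <= t -> V r w @[r --> t^'+] --> V t w}.
  apply: filterS Wc => w /continuous_within_itvcyP[Wc0 Wr0] t.
  rewrite le_eqVlt => t0; apply: cvgD.
    by apply: cvgMl_tmp; exact/cvg_at_right_filter/cvg_id.
  case/predU1P : t0 => [<-//|t0].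
  by apply: cvg_at_right_filter; apply: Wc0; rewrite in_itv/= t0.
have NR0 : {ae P, forall w, (N 0 w)%:R = 0 :> R}.
  by apply: filterS N0 => w ->.
(* [a] and [b] are the limits of 1 - F(x - y) as y tends to 0 from below and from above; the claimed
   limit is their midpoint. *)
pose a := 1 - F x.
pose b := 1 - left_limit F x.
have := left_limit_itv d T R P (Y 0%N) x; rewrite -/F => /andP[L0 LF].
have := distribution_function_itv01 d T R P (Y 0%N) x.
rewrite -/F => /andP[F0 F1].
have -> : (2 - F x - left_limit F x) / 2 = a + (b - a) * 2^-1.
  by rewrite /a /b; lra.
(* [bm_normal] gives the law of increments and [W 0] vanishes only almost surely, hence the
   increment in place of [W t]. *)
pose U t := [set w | 0 < m * t + (W t w - W 0 w)].
have mU t : measurable (U t).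
  have mq : measurable_fun setT (fun w => m * t + (W t w - W 0 w)).
    by apply: measurable_funD => //; exact: measurable_funB.
  have := mq measurableT _ (measurable_itv `]0, +oo[).
  rewrite setTI; congr (measurable _).
  by apply/seteqP; split => w /=; rewrite in_itv/= andbT.
have PU : fine (P (U t)) @[t --> 0^'+] --> (2^-1 : R).
  apply: cvg_trans (normal_prob_drift_cvg _ m); apply: near_eq_cvg.
  near=> t; have t0 : 0 < t by near: t; exact: nbhs_right_gt.
  rewrite -{1}(subr0 t) -Wn//; congr (fine (P _)).
  by apply/seteqP; split => w; rewrite /U /= in_itv/= andbT => h; lra.
(* Convergence in the extended reals to a finite limit amounts to eventual finiteness together with
   convergence of the real parts. *)
suff main : forall e : R, 0 < e -> \forall t \near (0 : R)^'+,
    'E_P[(fun w => \1_[set w' | (t%:E < tau w')%E] w * (1 - F (x - X t w)))%R]%E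
      \is a fin_num /\
    `|a + (b - a) * 2^-1 - fine 'E_P[(fun w =>
      \1_[set w' | (t%:E < tau w')%E] w * (1 - F (x - X t w)))%R]%E| <= e.
  apply/fine_cvgP; split; first by apply: filterS (main 1 ltr01) => t [].
  by apply/cvgrPdist_le => e /main; apply: filterS => t [].
(* Four errors share [e]: the approximation of the integrand by [g], the complements of [A1] and
   [A2], and the distance of P(U t) from 1/2. *)
move=> e e0; have e4 : 0 < e / 4 by rewrite divr_gt0.
have [c [c0 cx Fc]] : exists c, [/\ 0 < c, c < x & forall y, `|y| <= c ->
    `|(1 - F (x - y)) - (a + (b - a) * (0 < y)%R%:R)| <= e / 4].
  near (0 : R)^'+ => c; exists c; split.
  - by near: c; exact: nbhs_right_gt.
  - by near: c; exact: nbhs_right_lt.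
  have -> : b - a = F x - left_limit F x by rewrite /a /b; lra.
  by near: c; exact: ccdf_near_jump.
have [b1 b10 [A1 [mA1 PA1 A1P]]] :=
  right_continuous_uniformly_small d T R P V c (e / 4) mV V0 Vr c0 e4.
(* The threshold 1/2 forces the integer-valued [N] to be 0, so that there is no jump before [b2]. *)
have [b2 b20 [A2 [mA2 PA2 A2P]]] := right_continuous_uniformly_small d T R P
  (fun t w => (N t w)%:R) 2^-1 (e / 4) mN NR0 Nr ltac:(by []) e4.
near=> t.
have t0 : 0 < t by near: t; exact: nbhs_right_gt.
have tb1 : t < b1 by near: t; exact: nbhs_right_lt.
have tb2 : t < b2 by near: t; exact: nbhs_right_lt.
have small w : (A1 `&` A2) w -> W 0 w = 0 /\ forall s, 0 <= s < Num.min b1 b2 ->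
    X s w = V s w /\ `|V s w| <= c.
  move=> [/A1P[Vw0 Vw] /A2P[_ Nw]]; split.
    by move: Vw0; rewrite /V mulr0 add0r.
  move=> s /andP[s0]; rewrite lt_min => /andP[sb1 sb2].
  split; last by apply: Vw; rewrite s0.
  have : `|(N s w)%:R| <= 2^-1 :> R by apply: Nw; rewrite s0.
  rewrite /X /jump_diffusion; case: (N s w) => [_|n].
    by rewrite big_ord0 addr0.
  rewrite normr_nat => h; exfalso; have : (1 : R) <= n.+1%:R by rewrite ler1n.
  by move: h; lra.
pose g w : R := a + (b - a) * \1_(U t) w.
have ba : 0 <= b - a by rewrite /a /b; lra.
have mg : measurable_fun setT g.
  by apply: measurable_funD => //; exact: measurable_funM.
have g01 w : 0 <= g w <= 1.
  rewrite /g indicE; case: (_ \in _); rewrite /= /a /b; lra.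
have f01 w : 0 <= \1_[set w' | (t%:E < tau w')%E] w * (1 - F (x - X t w)) <= 1.
  have := distribution_function_itv01 d T R P (Y 0%N) (x - X t w).
  rewrite -/F => /andP[? ?]; rewrite indicE.
  by case: (_ \in _); rewrite /= ?mul1r ?mul0r; lra.
have fg w : (A1 `&` A2) w ->
    `|\1_[set w' | (t%:E < tau w')%E] w * (1 - F (x - X t w)) - g w| <= e / 4.
  move=> /small[Ww0 h].
  (* Before time [Num.min b1 b2] the path stays at or below c < x, so every passage time is at least
     this minimum, which exceeds [t]. *)
  have ttau : (t%:E < tau w)%E.
    apply: (@lt_le_trans _ _ (Num.min b1 b2)%:E).
      by rewrite lte_fin lt_min tb1.
    apply: le_ereal_inf_tmp => _ [s [s0 xs] <-]; rewrite lee_fin leNgt.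
    apply/negP => sb; have [XV Vc] := h s ltac:(by rewrite s0).
    have := ler_norm (V s w); move: xs; rewrite XV; lra.
  have [|XV Vc] := h t; first by rewrite ltW//= lt_min tb1.
  rewrite indicE mem_set//= mul1r XV.
  have -> : g w = a + (b - a) * (0 < V t w)%R%:R.
    suff UV : (w \in U t) = (0 < V t w) by rewrite /g indicE UV.
    by apply/idP/idP => [/set_mem|Vw]; [|apply/mem_set; move: Vw];
      rewrite /U /V /= Ww0 subr0.
  exact: Fc.
have [fE fgE] := expectation_dist_le d T R P _ g _ _ mg
  (measurableI _ _ mA1 mA2) (ltW e4) f01 g01 fg.
split => //.
have PA : fine (P (~` (A1 `&` A2))) <= e / 4 + e / 4.
  rewrite -lee_fin fineK ?fin_num_measure//; last first.
    by apply: measurableC; exact: measurableI.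
  have [mC1 mC2] := (measurableC mA1, measurableC mA2).
  rewrite setCI (le_trans (measureU2 _ mC1 mC2))// EFinD.
  by rewrite leeD// -[leLHS]fineK ?lee_fin// fin_num_measure.
have PUt : `|2^-1 - fine (P (U t))| <= e / 4.
  by near: t; exact: (cvgrPdist_le _ _).1 PU _ e4.
move: fgE; rewrite /g expectation_two_valued//=.
set p := fine (P (U t)) in PUt *; set q := fine 'E_P[_]%E => fgE.
(* The jump [b - a] of F at x is at most 1, so the error on the probability is not amplified. *)
have : `|(b - a) * (2^-1 - p)| <= e / 4.
  rewrite normrM (ger0_norm ba) (le_trans _ PUt)// ler_piMl//.
  by rewrite /a /b; lra.
move: fgE; rewrite mulrBr !ler_norml => /andP[? ?] /andP[? ?]; lra.
Unshelve. all: by end_near. Qed.
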